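(* Let $\mathcal{A}$ be an alphabet, $\mathcal{V}$ a family of blurred sets of $\mathcal{A}$, $\Lambda\subset\mathcal{A}^{\mathbb{N}}$ a shift space and $\Sigma_\Lambda=\Sigma_\Lambda^{\mathcal{V}}$ its blur shift space. Suppose that for every letter $a\in B_1(\Lambda)$ and every $u\in B(\Lambda)$ there is a finite number of sets in $\mathcal{V}_\Lambda$ that cover all except a finite number of elements of $\mathcal{F}_\Lambda(au)$. Then $\Sigma_\Lambda$ is locally compact. If, in addition, the same property holds with the empty word $\epsilon$ in place of $a$ (i.e. for every $u\in B(\Lambda)$ finitely many sets in $\mathcal{V}_\Lambda$ cover all except finitely many elements of $\mathcal{F}_\Lambda(\epsilon u)=\mathcal{F}_\Lambda(u)$), then $\Sigma_\Lambda$ is compact.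
   Context: $\mathbb{N}=\{0,1,2,\dots\}$. An alphabet is a nonempty set $\mathcal{A}$. On $\mathcal{A}^{\mathbb{N}}$ the shift map is $\sigma((x_i)_i)=(x_{i+1})_i$. A shift space is a set $\Lambda\subset\mathcal{A}^{\mathbb{N}}$ consisting of all sequences in which no word of some given set of nonempty finite words occurs; equivalently, $\Lambda$ is closed in the product of discrete topologies and $\sigma(\Lambda)\subset\Lambda$. $B_n(\Lambda)$ is the set of words $x_0\dots x_{n-1}$ with $x\in\Lambda$, $B_0(\Lambda)=\{\epsilon\}$ (empty word), $B(\Lambda)=\bigcup_{n\ge0}B_n(\Lambda)$; in particular $B_1(\Lambda)$ is the set of letters occurring in $\Lambda$. For a word $w$, $\mathcal{F}_\Lambda(w)=\{a\in\mathcal{A}:\ wa\in B(\Lambda)\}$ (empty if $w\notin B(\Lambda)$). A family of blurred sets (a resolution) is any (possibly empty) family $\mathcal{V}$ of infinite subsets of $\mathcal{A}$ such that $|G\cap H|<\infty$ for all distinct $G,H\in\mathcal{V}$. To each $H\in\mathcal{V}$ one attaches a new symbol $\tilde H\notin\mathcal{A}$ (distinct symbols for distinct sets); $\tilde{\mathcal{V}}=\{\tilde H: H\in\mathcal{V}\}$, $\bar{\mathcal{A}}=\mathcal{A}\cup\tilde{\mathcal{V}}$, $\bar H=H\cup\{\tilde H\}$. The full blur shift is $\Sigma_{\mathcal{A}^{\mathbb{N}}}^{\mathcal{V}}=\mathcal{A}^{\mathbb{N}}\cup\{(x_0\dots x_{n-1}\tilde H\tilde H\tilde H\dots):\ n\ge0,\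 x_i\in\mathcal{A},\ H\in\mathcal{V}\}$. The blur shift space of $\Lambda$ is $\Sigma_\Lambda^{\mathcal{V}}=\Lambda\cup\{(a_0\dots a_{n-1}\tilde H\tilde H\dots):\ n\ge0,\ H\in\mathcal{V},\ a_0\dots a_{n-1}\in B(\Lambda),\ |\mathcal{F}_\Lambda(a_0\dots a_{n-1})\cap H|=\infty\}$. Also $\mathcal{V}_\Lambda=\{H\in\mathcal{V}:\ |B_1(\Lambda)\cap H|=\infty\}$. Topology: $\Sigma_{\mathcal{A}^{\mathbb{N}}}^{\mathcal{V}}$ carries the topology with basis the generalized cylinders $Z(w_0\dots w_{n-1})=\{x: x_i=w_i,\ 0\le i\le n-1\}$ and $Z(w_0\dots w_{n-1}\bar H,F)=\{x: x_i=w_i,\ 0\le i\le n-1,\ x_n\in\bar H\setminus F\}$, where $n\ge0$, $w_i\in\mathcal{A}$, $H\in\mathcal{V}$, $F\subset H$ finite; $\Sigma_\Lambda^{\mathcal{V}}$ carries the induced topology. Locally compact means that every point has a compact neighbourhood. *)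

(* Defs.v *)
From HB Require Import structures.
From mathcomp Require Import all_boot.
From mathcomp Require Import all_classical.
From mathcomp Require Import topology.

Set Implicit Arguments.
Unset Strict Implicit.
Unset Printing Implicit Defensive.

Local Open Scope classical_set_scope.

Section ShiftSpaces.
Variable A : Type.
Implicit Types (L : set (nat -> A)) (w : seq A).

Definition occurs w (x : nat -> A) : Prop :=
  exists i, mkseq (fun j => x (i + j)) (size w) = w.

Definition shift_space L : Prop :=
  exists2 P : set (seq A), ~ P [::] &
    L = [set x | forall w, P w -> ~ occurs w x].

(* The length 0 is singled out so that the empty word belongs to the language
   even when L is empty. *)
Definition words L (n : nat) : set (seq A) :=
  if n is 0 then [set [::]] else [set mkseq x n | x in L].

Definition language L : set (seq A) := \bigcup_n words L n.

Definition letters L : set A := [set a | words L 1 [:: a]].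

Definition followers L w : set A := [set a | language L (rcons w a)].

End ShiftSpaces.

Section BlurShifts.
Variables (A : Type) (V : set (set A)).

Definition blurred_family : Prop :=
  (forall H, V H -> infinite_set H) /\
  (forall G H, V G -> V H -> G <> H -> finite_set (G `&` H)).

(* [inl a] is the letter a and [inr H] is the new symbol attached to H. *)
Definition blur_alphabet : Type := (A + V)%type.

Definition letter (a : A) : blur_alphabet := inl a.
Definition tilde (H : V) : blur_alphabet := inr H.

Definition bar (H : V) : set blur_alphabet :=
  letter @` set_val H `|` [set tilde H].

Definition letter_seq (y : nat -> A) : nat -> blur_alphabet :=
  fun i => letter (y i).

(* w followed by infinitely many copies of [tilde H] *)
Definition blur_seq (w : seq A) (H : V) : nat -> blur_alphabet :=
  nth (tilde H) (map letter w).

Definition full_blur_seqs : set (nat -> blur_alphabet) :=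
  [set x | (exists y, x = letter_seq y) \/ (exists w H, x = blur_seq w H)].

Definition full_blur_shift : Type := set_type full_blur_seqs.

HB.instance Definition _ := gen_eqMixin full_blur_shift.
HB.instance Definition _ := gen_choiceMixin full_blur_shift.

Definition blur_coord (x : full_blur_shift) : nat -> blur_alphabet := \val x.
Coercion blur_coord : full_blur_shift >-> Funclass.

Definition cylinder (w : seq A) : set full_blur_shift :=
  [set x | mkseq x (size w) = map letter w].

Definition blur_cylinder (w : seq A) (H : V) (F : set A) :
    set full_blur_shift :=
  [set x | mkseq x (size w) = map letter w /\
           (bar H `\` letter @` F) (x (size w))].

Definition generalized_cylinder : set (set full_blur_shift) :=
  [set C | (exists w, C = cylinder w) \/
     (exists w H F, [/\ finite_set F, F `<=` set_val H
                      & C = blur_cylinder w H F])].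

Lemma eq_mkseqP (T : Type) (f g : nat -> T) n :
  mkseq f n = mkseq g n <-> forall i, i < n -> f i = g i.
Proof.
split=> [e i lin|e]; last first.
  by apply: (@eq_from_nth _ (f 0)); rewrite ?size_mkseq// => i lin;
    rewrite !nth_mkseq ?e.
by have := congr1 (fun s => nth (f 0) s i) e; rewrite !nth_mkseq.
Qed.

Lemma cylinder_seq w (x : full_blur_shift) : cylinder w x ->
  forall i, i < size w -> exists a, x i = letter a.
Proof.
rewrite /cylinder/= => + i.
case: w => // a w /(congr1 (fun s => nth (letter a) s i)) + lin.
by rewrite nth_mkseq// (nth_map a)// => ->; eexists.
Qed.

Lemma cylinder_eq w (x z : full_blur_shift) : cylinder w x ->
  (forall i, i < size w -> z i = x i) -> cylinder w z.
Proof. by rewrite /cylinder/= => <- /eq_mkseqP. Qed.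

Lemma blur_cylinder_sub w (H : V) (x : full_blur_shift) C :
  generalized_cylinder C -> C x -> blur_coord x = blur_seq w H ->
  exists F, [/\ finite_set F, F `<=` set_val H & blur_cylinder w H F `<=` C].
Proof.
move=> gC Cx xE.
have xw : cylinder w x.
  rewrite /cylinder/= xE; apply: (@eq_from_nth _ (tilde H)).
    by rewrite size_mkseq size_map.
  by rewrite size_mkseq => i ?; rewrite nth_mkseq.
have agree F z : blur_cylinder w H F z -> forall i, i < size w -> z i = x i.
  by move=> [zw _]; apply/eq_mkseqP; rewrite zw -xw.
have le_size v : cylinder v x -> size v <= size w.
  move=> /cylinder_seq h; rewrite leqNgt; apply/negP => /h[a].
  by rewrite xE /blur_seq nth_default// size_map.
case: gC => [[v Cv]|[v [K [F [finF FK Cv]]]]]; subst C.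
  exists set0; split => // z /agree h; apply: (cylinder_eq Cx) => i iv.
  by apply: h; exact: (leq_trans iv (le_size _ Cx)).
case: Cx => vx xv; have := le_size _ vx; rewrite leq_eqVlt => /orP[/eqP vw|vw].
  have wv : w = v.
    have : map letter w = map letter v by rewrite -vx -xw vw.
    by apply: inj_map => ? ? [].
  subst v; suff HK : H = K by subst K; exists F; split=> //.
  have : x (size w) = tilde H by rewrite xE /blur_seq nth_default// size_map.
  by case: xv => [[[? _ <-]|->] _ //] [].
exists set0; split => // z /agree h; split.
  apply: (cylinder_eq vx) => i iv; apply: h; exact: ltn_trans vw.
by rewrite h.
Qed.

Lemma cylinder_sub (x : full_blur_shift) y C :
  generalized_cylinder C -> C x -> blur_coord x = letter_seq y ->
  exists n, forall m, n <= m -> cylinder (mkseq y m) `<=` C.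
Proof.
move=> gC Cx xE.
have agree m z : cylinder (mkseq y m) z -> forall i, i < m -> z i = x i.
  rewrite /cylinder/= size_mkseq => e; apply/eq_mkseqP; rewrite e xE.
  by rewrite /mkseq -map_comp.
case: gC => [[v Cv]|[v [K [F [finF FK Cv]]]]]; subst C.
  exists (size v) => m vm z /agree h; apply: (cylinder_eq Cx) => i iv.
  by apply: h; exact: leq_trans vm.
exists (size v).+1 => m vm z /agree h; case: Cx => vx xv; split; last by rewrite h.
apply: (cylinder_eq vx) => i iv.
by apply: h; apply: leq_trans vm; rewrite ltnS ltnW.
Qed.

Lemma generalized_cylinder_cover :
  \bigcup_(C in generalized_cylinder) C = [set: full_blur_shift].
Proof.
by rewrite -subTset => x _; exists (cylinder [::]) => //; left; exists [::].
Qed.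

Lemma generalized_cylinder_join (C D : set full_blur_shift) x :
  generalized_cylinder C -> generalized_cylinder D -> C x -> D x ->
  exists E, [/\ generalized_cylinder E, E x & E `<=` C `&` D].
Proof.
move=> gC gD Cx Dx; case: (set_valP x) => [[y xE]|[w [H xE]]].
  have [n nC] := cylinder_sub gC Cx xE; have [m mD] := cylinder_sub gD Dx xE.
  exists (cylinder (mkseq y (maxn n m))); split; first by left; eexists.
    rewrite /cylinder/= size_mkseq /blur_coord xE /mkseq -map_comp.
    exact: eq_map.
  rewrite subsetI; split; [apply: nC|apply: mD].
    exact: leq_maxl.
  exact: leq_maxr.
have [F [finF FH FC]] := blur_cylinder_sub gC Cx xE.
have [G [finG GH GD]] := blur_cylinder_sub gD Dx xE.
exists (blur_cylinder w H (F `|` G)); split.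
- right; exists w, H, (F `|` G); split=> //; first by rewrite finite_setU.
  by rewrite subUset.
- split.
    rewrite /blur_coord xE; apply: (@eq_from_nth _ (tilde H)).
      by rewrite size_mkseq size_map.
    by rewrite size_mkseq => i ?; rewrite nth_mkseq.
  by rewrite /blur_coord xE /blur_seq nth_default ?size_map//; split;
    [right|case].
- rewrite subsetI; split=> z [zw [zH zFG]].
    by apply: FC; split=> //; split=> // -[a Fa az]; apply: zFG; exists a => //; left.
  by apply: GD; split=> //; split=> // -[a Ga az]; apply: zFG; exists a => //; right.
Qed.

HB.instance Definition _ := @isBaseTopological.Build full_blur_shift
  (set full_blur_shift) generalized_cylinder id
  generalized_cylinder_cover generalized_cylinder_join.

Variable L : set (nat -> A).

(* As a type ([set_type]), this set carries the induced topology. *)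
Definition blur_shift : set full_blur_shift :=
  [set x | (exists2 y, L y & blur_coord x = letter_seq y) \/
     (exists w H, [/\ language L w,
                      infinite_set (followers L w `&` set_val H)
                    & blur_coord x = blur_seq w H])].

Definition blurred_in : set (set A) :=
  [set H | V H /\ infinite_set (letters L `&` H)].

Definition finitely_covered (X : set A) : Prop :=
  exists S : set (set A),
    [/\ finite_set S, S `<=` blurred_in
      & finite_set (X `\` \bigcup_(H in S) H)].

End BlurShifts.

Arguments blur_shift {A} V L.

(* [topology.locally_compact] asks in addition that the compact neighbourhood
   be closed. *)
Definition locally_compact_space (T : topologicalType) : Prop :=
  forall x : T, exists2 K : set T, nbhs x K & compact K.

(* Main.v *)
Require Import Defs.
From mathcomp Require Import all_boot.
From mathcomp Require Import all_classical.
From mathcomp Require Import topology.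

(** The proof follows an ultrafilter [U] on the blur shift down the tree of
    words.  If the cylinder of a word [v] belongs to [U] and the followers of
    [v] are finitely covered, then finitely many sets fill that cylinder: the
    cylinders of [rcons v a] for the finitely many exceptional letters [a], and
    the blurred cylinders of [v] and [H] for the finitely many covering sets
    [H].  No other blurred set [K] can contribute a point
    [v ~K ~K ...]: the infinite set of followers of [v] in [K] would meet one
    of the covering sets infinitely often, and distinct blurred sets are almost
    disjoint.  So [U] contains one of these sets
    ([cylinder_finitely_covered]); this is recorded as [descends U v].

    Suppose that [U] descends at each word whose cylinder it contains.  Either
    one can extend the word by a letter for ever, and [U] converges to the
    infinite sequence of these letters, which lies in the shift space because
    forbidden words are finite; or one gets stuck at some [v] with a
    blurred cylinder of [v] and [H] in [U] and no cylinder of [rcons v a] in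
    [U].  In the second case all the sets obtained from that blurred cylinder
    by removing finitely many letters are in [U], and these are the basic
    neighbourhoods of [v ~H ~H ...]; that point is in the blur shift because
    otherwise removing the finitely many followers of [v] in [H] would leave
    the empty set.  This is [descent_converges].

    As generalized cylinders are closed, a generalized cylinder is
    compact as soon as every ultrafilter containing it descends
    ([descent_compact]).  The whole space, the cylinder of a one-letter word,
    and the blurred cylinder of the empty word (where the first step of the
    descent is given) are the three instances used. *)

Set Implicit Arguments.
Unset Strict Implicit.
Unset Printing Implicit Defensive.

Local Open Scope classical_set_scope.

(** * Ultrafilters *)

Lemma ultra_bigcup (T I : Type) (U : set_system T) (D : set I)
    (f : I -> set T) :
  UltraFilter U -> finite_set D -> U (\bigcup_(i in D) f i) ->
  exists2 i, D i & U (f i).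
Proof.
move=> UU finD UDf; apply: contrapT => noUf.
(* The classical choice structure on [I] makes the finite set [D] a [fset]. *)
have [X DX] := (@finite_fsetP {classic I} D).1 finD.
have : U (\bigcap_(i in D) ~` f i).
  rewrite {1}DX; apply: (@filter_bigI T {classic I}) => i iX.
  have [Ufi|//] := in_ultra_setVsetC (f i) UU.
  by exfalso; apply: noUf; exists i => //; rewrite DX; exact: iX.
move=> /(filterI UDf) /filter_ex[x [[i Di fix_] /(_ i Di)]].
exact.
Qed.

(** * Languages of shift spaces *)

Section Language.
Context {A : Type}.
Implicit Types (L : set (nat -> A)) (w : seq A).

Lemma languageP L w :
  language L w <-> w = [::] \/ exists2 y, L y & mkseq y (size w) = w.
Proof.
split=> [[[|n] _ /=]|[->|[y Ly wE]]]; first by left.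
- by move=> [y Ly <-]; right; exists y => //; rewrite size_mkseq.
- by exists 0.
- exists (size w) => //; case: w wE => //= a w wE.
  by exists y.
Qed.

Lemma language_mkseq L y n : L y -> language L (mkseq y n).
Proof. by move=> Ly; apply/languageP; right; exists y; rewrite ?size_mkseq. Qed.

Lemma language_take L w n : language L w -> language L (take n w).
Proof.
move=> /languageP[->|[y Ly <-]]; first exact/languageP/or_introl.
by rewrite /mkseq -map_take take_iota; exact: language_mkseq.
Qed.

Lemma language_head L a w : language L (a :: w) -> letters L a.
Proof.
move=> /languageP[//|[y Ly]] [<- _].
by exists y.
Qed.

Lemma language_behead L a w :
  shift_space L -> language L (a :: w) -> language L w.
Proof.
move=> [P _ ->] /languageP[//|[y Ly]] [_ wE]; apply/languageP; right.
exists (fun i => y i.+1) => [v Pv [i iE]|]; last first.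
  by rewrite -[RHS]wE -[1]addn0 iotaDl -map_comp.
by apply: (Ly v Pv); exists i.+1; rewrite -[RHS]iE.
Qed.

(** A forbidden word that occurs in [y] lies in a prefix of [y], hence occurs in
    any point of [L] sharing that prefix. *)
Lemma shift_space_closed L y :
  shift_space L -> (forall n, language L (mkseq y n)) -> L y.
Proof.
move=> [P P0 LP] Ly; rewrite LP => w Pw [i wE].
(* Since [w] is nonempty, so is the prefix below, and it comes from a point. *)
have w0 : 0 < size w by case: w Pw {wE} => // /P0.
have /languageP[e|[z]] := Ly (i + size w).
  by have := size_mkseq y (i + size w); rewrite e => /esym/eqP;
    rewrite addn_eq0 => /andP[_]; rewrite eqn0Ngt w0.
rewrite LP size_mkseq => /(_ w Pw) zw /eq_mkseqP zy; apply: zw; exists i.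
rewrite -[RHS]wE; apply/eq_mkseqP => j jw.
by rewrite zy// ltn_add2l.
Qed.

End Language.

(** * Generalized cylinders *)

Section Cylinders.
Context {A : Type} {V : set (set A)}.
Implicit Types (w v : seq A) (H K : V) (F : set A) (x z : full_blur_shift V).


Lemma cylinder_nil x : cylinder [::] x.
Proof. by []. Qed.

Lemma cylinder_inj w v x :
  size w = size v -> cylinder w x -> cylinder v x -> w = v.
Proof.
rewrite /cylinder/= => -> -> /inj_map; apply=> a b.
by case.
Qed.

Lemma cylinder_rcons w a x :
  cylinder (rcons w a) x <-> cylinder w x /\ x (size w) = letter V a.
Proof.
rewrite /cylinder/= size_rcons mkseqS map_rcons; split=> [|[-> -> //]].
by move=> /rcons_inj[].
Qed.

Lemma blur_seq_tilde w H : blur_seq w H (size w) = tilde H.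
Proof. by rewrite /blur_seq nth_default ?size_map. Qed.

Lemma cylinder_blur_seq w H x : blur_coord x = blur_seq w H -> cylinder w x.
Proof.
rewrite /cylinder/= => ->; apply: (@eq_from_nth _ (tilde H)).
  by rewrite size_mkseq size_map.
by rewrite size_mkseq => i iw; rewrite nth_mkseq.
Qed.

Lemma cylinder_blur_seq_size w u H x :
  blur_coord x = blur_seq u H -> cylinder w x -> size w <= size u.
Proof.
move=> xE /cylinder_seq xw; rewrite leqNgt; apply/negP => /xw[a].
by rewrite xE blur_seq_tilde.
Qed.

Lemma blur_cylinder_blur_seq w H F x :
  blur_coord x = blur_seq w H -> blur_cylinder w H F x.
Proof.
move=> xE; split; first exact: cylinder_blur_seq xE.
by rewrite xE blur_seq_tilde; split; [right|case].
Qed.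

Lemma blur_cylinder_agree w H F x z :
  blur_coord x = blur_seq w H -> blur_cylinder w H F z ->
  forall i, i < size w -> z i = x i.
Proof.
move=> /cylinder_blur_seq xw [zw _]; apply/eq_mkseqP.
by rewrite zw xw.
Qed.

Lemma cylinder_mkseq_agree y n x z :
  blur_coord x = letter_seq V y -> cylinder (mkseq y n) z ->
  forall i, i < n -> z i = x i.
Proof.
rewrite /cylinder/= size_mkseq => xE zy; apply/eq_mkseqP.
by rewrite zy xE /mkseq -map_comp.
Qed.

Lemma cylinder_mkseq y n x :
  blur_coord x = letter_seq V y -> cylinder (mkseq y n) x.
Proof.
by rewrite /cylinder/= size_mkseq => ->; rewrite /mkseq -map_comp.
Qed.

Lemma generalized_cylinder_cylinder w :
  generalized_cylinder (@cylinder A V w).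
Proof. by left; exists w. Qed.

Lemma generalized_cylinder_blur w H F :
  finite_set F -> F `<=` set_val H -> generalized_cylinder (blur_cylinder w H F).
Proof. by right; exists w, H, F. Qed.

Lemma generalized_cylinder_blur0 w H :
  generalized_cylinder (blur_cylinder w H set0).
Proof. exact: generalized_cylinder_blur. Qed.

Lemma generalized_cylinder_open (C : set (full_blur_shift V)) :
  generalized_cylinder C -> open C.
Proof.
move=> gC; exists [set C] => [_ -> //|].
by rewrite bigcup_set1.
Qed.

Lemma open_generalized_cylinder (O : set (full_blur_shift V)) x :
  open O -> O x -> exists C, [/\ generalized_cylinder C, C x & C `<=` O].
Proof.
move=> [D Dgen <-] [C DC Cx]; exists C; split=> //; first exact: Dgen.
exact: bigcup_sup.
Qed.

Lemma closure_generalized_cylinder (B C : set (full_blur_shift V)) x :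
  closure B x -> generalized_cylinder C -> C x -> exists2 z, B z & C z.
Proof.
move=> Bx gC Cx; have [|z [Bz Cz]] := Bx C; last by exists z.
by apply: open_nbhs_nbhs; split=> //; exact: generalized_cylinder_open.
Qed.

(** A point [u ~K ~K ...] outside the cylinder has a neighbourhood avoiding it:
    when [u] is shorter than [w], remove from the blurred cylinder of [u] and
    [K] the letter of [w] at position [size u]. *)
Lemma cylinder_closed w : closed (@cylinder A V w).
Proof.
move=> x wx; have [[y xE]|[u [K xE]]] := set_valP x.
  have [z zw zy] := closure_generalized_cylinder wx
    (generalized_cylinder_cylinder _) (cylinder_mkseq (size w) xE).
  by apply: cylinder_eq zw _ => i iw; rewrite (cylinder_mkseq_agree xE zy).
have [wu|uw] := leqP (size w) (size u).
  have [z zw zu] := closure_generalized_cylinder wx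
    (generalized_cylinder_cylinder _) (cylinder_blur_seq xE).
  apply: cylinder_eq zw _ => i /leq_trans/(_ wu) iu; apply/esym.
  by move: i iu; apply/eq_mkseqP; rewrite zu (cylinder_blur_seq xE).
case: w uw wx => // a0 w uw wx.
pose F := set_val K `&` [set nth a0 (a0 :: w) (size u)].
have [z zw [_ [zK zF]]] : exists2 z, cylinder (a0 :: w) z & blur_cylinder u K F z.
  apply: closure_generalized_cylinder wx _ (blur_cylinder_blur_seq _ xE).
  apply: generalized_cylinder_blur; last exact: subIsetl.
  by apply: finite_setIr; exact: finite_set1.
have := congr1 (fun s => nth (letter V a0) s (size u)) zw.
rewrite nth_mkseq// (nth_map a0)// => zu; exfalso; apply: zF.
exists (nth a0 (a0 :: w) (size u)) => //; split=> //.
by move: zK; rewrite zu => -[[b Kb [<-]]|].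
Qed.

(** The only delicate limit point is [w ~K ~K ...] with [K] distinct from [H]:
    removing the finite set of letters common to [K] and [H] from the blurred
    cylinder of [w] and [K] makes it disjoint from the one of [w] and [H]. *)
Lemma blur_cylinder_closed w H F :
  blurred_family V -> closed (blur_cylinder w H F).
Proof.
move=> [_ Vfin] x cx.
have wx : cylinder w x.
  by apply: cylinder_closed; apply: closureS cx => z [].
split=> //; have [[y xE]|[u [K xE]]] := set_valP x.
  have [z [_ zHF] zy] := closure_generalized_cylinder cx
    (generalized_cylinder_cylinder _) (cylinder_mkseq (size w).+1 xE).
  by rewrite -(cylinder_mkseq_agree xE zy).
have := cylinder_blur_seq_size xE wx; rewrite leq_eqVlt => /orP[/eqP wu|wu].
  have {}wu := cylinder_inj wu wx (cylinder_blur_seq xE); subst u.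
  rewrite [blur_coord x]xE blur_seq_tilde.
  have [<-|KH] := pselect (K = H); first by split; [right|case].
  have finKH : finite_set (set_val K `&` set_val H).
    apply: Vfin; [exact: set_valP|exact: set_valP|].
    by move=> /val_inj.
  have [z [_ [zH _]] [_ [zK zKH]]] := closure_generalized_cylinder cx
    (generalized_cylinder_blur w finKH (@subIsetl _ _ _))
    (blur_cylinder_blur_seq _ xE).
  exfalso; case: zH zK zKH => [[a Ha <-]|->].
    by move=> [[b Kb [ba]]|//]; apply; exists a => //; split=> //; rewrite -ba.
  by move=> [[b //]|[HK]]; rewrite HK in KH.
have [z [_ zHF] zu] := closure_generalized_cylinder cx
  (generalized_cylinder_blur0 _ _) (blur_cylinder_blur_seq _ xE).
by rewrite -(blur_cylinder_agree xE zu).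
Qed.

End Cylinders.

(** * Points and topology of the blur shift of [L] *)

Section BlurShift.
Context {A : Type} {V : set (set A)} {L : set (nat -> A)}.
Implicit Types (w v : seq A) (H K : V) (F : set A) (x z : blur_shift V L).

Definition trace (C : set (full_blur_shift V)) : set (blur_shift V L) :=
  set_val @^-1` C.

Lemma trace_cylinder_language w x : trace (cylinder w) x -> language L w.
Proof.
rewrite /trace/= => wx; have [[y Ly xE]|[u [H [Lu _ xE]]]] := set_valP x.
  rewrite (cylinder_inj _ wx (cylinder_mkseq (size w) xE)) ?size_mkseq//.
  exact: language_mkseq.
have wu := cylinder_blur_seq_size xE wx.
suff -> : w = take (size w) u by exact: language_take.
apply: (@inj_map _ _ (letter V)) => [a b []//|].
rewrite map_take -(cylinder_blur_seq xE) -wx /mkseq -map_take take_iota.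
by rewrite (minn_idPl wu).
Qed.

(** A point of the blur shift starting with [w] continues either by a letter or
    by the symbol of a set that meets the followers of [w] infinitely often. *)
Lemma trace_cylinder_next w x : trace (cylinder w) x ->
  (exists a, trace (cylinder (rcons w a)) x) \/
  (exists H, infinite_set (followers L w `&` set_val H) /\
             blur_coord (set_val x) = blur_seq w H).
Proof.
rewrite /trace/= => wx; have [[y Ly xE]|[u [H [Lu infH xE]]]] := set_valP x.
  by left; exists (y (size w)); apply/cylinder_rcons; rewrite xE.
have := cylinder_blur_seq_size xE wx; rewrite leq_eqVlt => /orP[/eqP wu|wu].
  have {}wu := cylinder_inj wu wx (cylinder_blur_seq xE); subst u.
  by right; exists H.
have [a xa] := cylinder_seq (cylinder_blur_seq xE) wu.
by left; exists a; apply/cylinder_rcons.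
Qed.

Lemma nbhs_trace C x : generalized_cylinder C -> trace C x -> nbhs x (trace C).
Proof.
move=> gC Cx; apply: open_nbhs_nbhs; split=> //.
by exists C => //; exact: generalized_cylinder_open.
Qed.

Lemma cvg_trace (U : set_system (blur_shift V L)) x : Filter U ->
  (forall C, generalized_cylinder C -> trace C x -> U (trace C)) -> U --> x.
Proof.
move=> FU Ux B [_ [[O oO <-] Ox OB]].
have [C [gC Cx CO]] := open_generalized_cylinder oO Ox.
by apply: filterS (Ux _ gC Cx) => z Cz; apply: OB; exact: CO.
Qed.

Lemma trace_closed C : closed C -> closed (trace C).
Proof.
by apply: preimage_closed => x _; exact: initial_continuous.
Qed.

(** * Descent of an ultrafilter along the words *)

(** What an ultrafilter containing the cylinder of [v] must offer for the
    construction of its limit to go on: a longer word, or a candidate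
    [v ~H ~H ...] for the limit. *)
Definition descends (U : set_system (blur_shift V L)) v : Prop :=
  (exists a, U (trace (cylinder (rcons v a)))) \/
  (exists H, U (trace (blur_cylinder v H set0))).

(** The finitely many exceptional letters and covering sets index a finite
    cover of the cylinder of [v], and an ultrafilter picks one of its members. *)
Lemma cylinder_finitely_covered (U : set_system (blur_shift V L)) v :
  blurred_family V -> UltraFilter U -> U (trace (cylinder v)) ->
  finitely_covered V L (followers L v) -> descends U v.
Proof.
move=> [_ Vfin] UU Uv [S [finS SV finE]].
pose E := followers L v `\` \bigcup_(H in S) H.
pose SV' := [set H : V | S (set_val H)].
have : U ((\bigcup_(a in E) trace (cylinder (rcons v a))) `|`
          (\bigcup_(H in SV') trace (blur_cylinder v H set0))).
  apply: filterS Uv => x vx.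
  have [[a ax]|[K [infK xE]]] := trace_cylinder_next vx.
    have [[H SH Ha]|nSa] := pselect ((\bigcup_(H in S) H) a); last first.
      by left; exists a => //; split=> //; exact: trace_cylinder_language ax.
    have [VH _] := SV _ SH.
    right; exists (exist _ H (mem_set VH)) => //; split=> //.
    have /cylinder_rcons[_ ->] := ax.
    by split; [left; exists a|case].
  right; exists K; last exact: blur_cylinder_blur_seq.
  (* Were [K] not in [S], the followers of [v] in [K] would be finitely many:
     those outside the union of [S] are, and each member of [S] contains
     finitely many letters of [K]. *)
  apply: contrapT => nSK; apply: infK.
  apply: (@sub_finite_set _ _ (E `|` \bigcup_(H in S) (set_val K `&` H))).
    move=> a [va Ka]; have [[H SH Ha]|nSa] := pselect ((\bigcup_(H in S) H) a).
      by right; exists H.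
    by left.
  rewrite finite_setU; split=> //; apply: bigcup_finite => // H SH.
  apply: Vfin; [exact: set_valP|by have [] := SV _ SH|].
  by move=> KH; apply: nSK; rewrite /SV'/= KH.
move=> UE; have [UA|UA] :=
    in_ultra_setVsetC (\bigcup_(a in E) trace (cylinder (rcons v a))) UU.
  by left; have [a _ Ua] := ultra_bigcup UU finE UA; exists a.
have finSV : finite_set SV'.
  by apply: finite_preimage finS => H K _ _; exact: val_inj.
right; have [|H _ UH] := ultra_bigcup (f := fun H => trace (blur_cylinder v H set0))
    UU finSV; last by exists H.
by apply: filterS (filterI UE UA) => x [[//|]].
Qed.

(** Removing [F] from the blurred cylinder of [v] and [H] costs finitely many
    cylinders, none of which is in [U]. *)
Lemma blur_cylinder_stuck (U : set_system (blur_shift V L)) v H F :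
  UltraFilter U -> U (trace (blur_cylinder v H set0)) ->
  (forall a, ~ U (trace (cylinder (rcons v a)))) -> finite_set F ->
  U (trace (blur_cylinder v H F)).
Proof.
move=> UU UH Unext finF.
have [//|UnF] := in_ultra_setVsetC (trace (blur_cylinder v H F)) UU.
have [|a _ /Unext//] :=
  ultra_bigcup (f := fun a => trace (cylinder (rcons v a))) UU finF.
apply: filterS (filterI UH UnF) => x [[vx [xH _]] nx].
apply: contrapT => nxF; apply: nx; split=> //; split=> // -[a Fa ax].
by apply: nxF; exists a => //; apply/cylinder_rcons.
Qed.

(** The limit is [v ~H ~H ...], whose basic neighbourhoods are in [U] by
    [blur_cylinder_stuck]. *)
Lemma stuck_converges (U : set_system (blur_shift V L)) v H :
  UltraFilter U -> U (trace (cylinder v)) ->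
  U (trace (blur_cylinder v H set0)) ->
  (forall a, ~ U (trace (cylinder (rcons v a)))) ->
  exists x : blur_shift V L, U --> x.
Proof.
move=> UU Uv UH Unext.
have UHF F := blur_cylinder_stuck UU UH Unext (F := F).
have Lv : language L v.
  by have [x /trace_cylinder_language] := filter_ex Uv.
have infH : infinite_set (followers L v `&` set_val H).
  (* Otherwise remove these followers from the blurred cylinder. *)
  move=> finH; have [x [vx [xH nxF]]] := filter_ex (UHF _ finH).
  have [[a ax]|[K [infK xE]]] := trace_cylinder_next vx.
    have Fa := trace_cylinder_language ax.
    have /cylinder_rcons[_ xa] := ax.
    apply: nxF; exists a => //; split=> //.
    by move: xH; rewrite xa => -[[b Hb [<-]]|].
  move: xH; rewrite xE blur_seq_tilde => -[[b //]|[KH]].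
  by apply: infK; rewrite KH.
have fullp : full_blur_seqs (blur_seq v H) by right; exists v, H.
pose p : full_blur_shift V := exist _ (blur_seq v H) (mem_set fullp).
have pL : blur_shift V L p by right; exists v, H.
exists (exist _ p (mem_set pL)); apply: cvg_trace => C gC Cp.
have [F [finF _ FC]] := blur_cylinder_sub gC Cp (erefl : blur_coord p = _).
by apply: filterS (UHF F finF) => x; exact: FC.
Qed.

(** The chosen letters form a sequence [y] all of whose prefixes have their
    cylinder in [U]. *)
Lemma endless_descent_converges (U : set_system (blur_shift V L)) :
  shift_space L -> [set: A] !=set0 -> UltraFilter U ->
  (forall v, U (trace (cylinder v)) ->
     exists a, U (trace (cylinder (rcons v a)))) ->
  exists x : blur_shift V L, U --> x.
Proof.
move=> shiftL [a0 _] UU Unext.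
have /choice[f fU] v : exists a, U (trace (cylinder v)) ->
    U (trace (cylinder (rcons v a))).
  (* Away from the words with their cylinder in [U], any letter will do. *)
  have [/Unext[a Ua]|nUv] := pselect (U (trace (cylinder v))).
    by exists a.
  by exists a0.
pose w n := iter n (fun v => rcons v (f v)) [::].
pose y n := f (w n).
have yw n : mkseq y n = w n by elim: n => // n IHn; rewrite mkseqS IHn.
have Uy n : U (trace (cylinder (mkseq y n))).
  rewrite yw; elim: n => [|n IHn]; last exact: fU.
  by apply: filterS filterT => x _; exact: cylinder_nil.
have Ly : L y.
  apply: shift_space_closed shiftL _ => n.
  by have [x /trace_cylinder_language] := filter_ex (Uy n).
have fully : full_blur_seqs (letter_seq V y) by left; exists y.
pose p : full_blur_shift V := exist _ (letter_seq V y) (mem_set fully).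
have pL : blur_shift V L p by left; exists y.
exists (exist _ p (mem_set pL)); apply: cvg_trace => C gC Cp.
have [n nC] := cylinder_sub gC Cp (erefl : blur_coord p = _).
by apply: filterS (Uy n) => x; exact: nC.
Qed.

Lemma descent_converges (U : set_system (blur_shift V L)) :
  shift_space L -> [set: A] !=set0 -> UltraFilter U ->
  (forall v, U (trace (cylinder v)) -> descends U v) ->
  exists x : blur_shift V L, U --> x.
Proof.
move=> shiftL A0 UU Udesc.
have [[v [Uv Unext]]|nostuck] := pselect (exists v, U (trace (cylinder v)) /\
    forall a, ~ U (trace (cylinder (rcons v a)))).
  have [[a /Unext//]|[H UH]] := Udesc v Uv.
  exact: stuck_converges UU Uv UH Unext.
apply: endless_descent_converges => // v Uv; apply: contrapT => nex.
by apply: nostuck; exists v; split=> // a Ua; apply: nex; exists a.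
Qed.

Lemma descent_compact (C : set (full_blur_shift V)) :
  shift_space L -> [set: A] !=set0 -> closed C ->
  (forall U : set_system (blur_shift V L), UltraFilter U -> U (trace C) ->
     forall v, U (trace (cylinder v)) -> descends U v) ->
  compact (trace C).
Proof.
move=> shiftL A0 /trace_closed clC Cdesc; rewrite compact_ultra => U UU UC.
have [x Ux] := descent_converges shiftL A0 UU (Cdesc U UU UC).
by exists x; split=> //; exact: (closed_cvg (u_ := id) _ clC UC x Ux).
Qed.

End BlurShift.

(** * Compactness *)

Theorem corollary3p29 (A : Type) (V : set (set A)) (L : set (nat -> A))
    (A_nonempty : [set: A] !=set0)
    (V_blurred : blurred_family V)
    (L_shift : shift_space L)
    (L_cov : forall (a : A) (u : seq A), letters L a -> language L u ->
       finitely_covered V L (followers L (a :: u))) :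
  locally_compact_space (blur_shift V L) /\
  ((forall u : seq A, language L u -> finitely_covered V L (followers L u)) ->
   compact [set: blur_shift V L]).
Proof.
(* The hypothesis covers all nonempty words in use, so only the first step of a
   descent needs an argument of its own. *)
have desc_cons (U : set_system (blur_shift V L)) a v : UltraFilter U ->
    U (trace (cylinder (a :: v))) -> descends U (a :: v).
  move=> UU Uv; apply: cylinder_finitely_covered => //.
  have [x /trace_cylinder_language Lav] := filter_ex Uv.
  by apply: L_cov; [exact: language_head Lav|exact: language_behead Lav].
split=> [x|cov]; last first.
  have -> : [set: blur_shift V L] = trace (cylinder [::]).
    by apply/seteqP; split=> // x _; exact: cylinder_nil.
  apply: descent_compact => // U UU _ v Uv.
  apply: cylinder_finitely_covered => //; apply: cov.
  by have [x /trace_cylinder_language] := filter_ex Uv.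
have [|[a ax]|[H [_ xE]]] := @trace_cylinder_next _ _ _ [::] x.
- exact: cylinder_nil.
- exists (trace (cylinder [:: a])).
    by apply: nbhs_trace => //; exact: generalized_cylinder_cylinder.
  apply: descent_compact => // [|U UU Ua [|b v] Uv]; first exact: cylinder_closed.
    by left; exists a.
  exact: desc_cons.
- exists (trace (blur_cylinder [::] H set0)).
    apply: nbhs_trace; first exact: generalized_cylinder_blur0.
    exact: blur_cylinder_blur_seq.
  apply: descent_compact => // [|U UU UH [|b v] Uv].
  + exact: blur_cylinder_closed.
  + by right; exists H.
  + exact: desc_cons.
Qed.
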